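(* Let $n>2$ be an integer and let $m\neq 0,\pm1$ be a square-free integer. Let $\vartheta=\sqrt[n]{m}$ and $K=\mathbb{Q}(\vartheta)$. Suppose that $(1,\vartheta,\ldots,\vartheta^{n-1})$ is not an integral basis of $K$. Then for any element \[ \alpha=\frac{a_0+a_1\vartheta+\cdots+a_{n-1}\vartheta^{n-1}}{q} \] of an integral basis of $K$ (with $a_0,\ldots,a_{n-1},q\in\mathbb{Z}$, $q>0$, and $\gcd(a_0,\ldots,a_{n-1},q)=1$), the denominator $q$ is divisible only by primes dividing $n$, and no prime factor of $q$ divides $m$.
   Context: An integral basis of $K$ is a $\mathbb{Z}$-basis of the ring of integers $\mathbb{Z}_K$ of $K$. *)

(* Defs.v *)
From mathcomp Require Import all_boot all_order all_algebra all_field.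

Set Implicit Arguments.
Unset Strict Implicit.
Unset Printing Implicit Defensive.

Import GRing.Theory.
Local Open Scope ring_scope.

Definition squarefree_int (m : int) : Prop :=
  forall d : int, (d ^+ 2 %| m)%Z -> d \is a GRing.unit.

Definition in_ring_of_integers (K : fieldExtType rat) (x : K) : Prop :=
  integralOver (intr : int -> K) x.

Definition integral_basis (K : fieldExtType rat) (k : nat)
    (b : k.-tuple K) : Prop :=
  [/\ forall i : 'I_k, in_ring_of_integers (tnth b i),
      forall c : 'I_k -> int,
        \sum_(i < k) (c i)%:~R * tnth b i = 0 -> forall i, c i = 0
    & forall x : K, in_ring_of_integers x ->
        exists c : 'I_k -> int, x = \sum_(i < k) (c i)%:~R * tnth b i].

(* Main.v *)
(** Call [Z[theta]] maximal at a prime [p] when an integer polynomial of degree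
    less than [n] whose value at [theta] is [p] times an algebraic integer has
    all its coefficients divisible by [p]; such a [p] cannot divide a reduced
    denominator.  For a root [theta] of a monic polynomial [f] of degree [n],
    this holds in two cases.

    If [f] is Eisenstein at [p], then [p | theta^n].  Let [g_j] be the first
    coefficient of [g] prime to [p]: multiplying [g(theta)] by [theta^(n-1-j)]
    shows that [p | g_j theta^(n-1)], and the equation of [theta] turns this
    into [p | g_j].

    If [f] is irreducible over [Q] and separable mod [p], clearing denominators
    in a monic equation of [g(theta) / p] shows that [f] divides a power of [g]
    mod [p], hence divides [g] mod [p], which vanishes since [deg g < n].

    For [f = X^n - m] with [m] square-free, the first case applies when [p | m],
    and the second when [p] divides neither [m] nor [n]. *)

From HB Require Import structures.
Require Import Defs.
From mathcomp Require Import all_boot all_order all_algebra all_field.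
From mathcomp Require Import ring.

Set Implicit Arguments.
Unset Strict Implicit.
Unset Printing Implicit Defensive.

Import Order.TTheory GRing.Theory.
Local Open Scope ring_scope.

Lemma Euclid_dvdzM (p : nat) (a b : int) : prime p ->
  (p %| a * b)%Z = (p %| a)%Z || (p %| b)%Z.
Proof. by move=> p_pr; rewrite !dvdzE abszM Euclid_dvdM. Qed.

Lemma Euclid_dvdzX (p : nat) (a : int) k : prime p ->
  (p %| a ^+ k)%Z = (p %| a)%Z && (0 < k)%N.
Proof. by move=> p_pr; rewrite !dvdzE abszX Euclid_dvdX. Qed.

Lemma dvdz_biggcd I (r : seq I) (P : pred I) (F : I -> int) (d q : int) :
  (d %| q)%Z -> (forall i, P i -> (d %| F i)%Z) ->
  (d %| \big[gcdz/q]_(i <- r | P i) F i)%Z.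
Proof.
by move=> d_q d_F; elim/big_ind: _ => // x y d_x d_y; rewrite dvdz_gcd d_x.
Qed.

Lemma squarefree_int_prime (p : nat) (m : int) :
  squarefree_int m -> prime p -> ~~ (p%:Z ^+ 2 %| m)%Z.
Proof.
move=> m_sqf p_pr; apply/negP => /m_sqf.
by rewrite qualifE /= orbF eqz_nat (gtn_eqF (prime_gt1 p_pr)).
Qed.

Lemma separable_dvdp_exp (F : fieldType) (f g : {poly F}) k :
  separable_poly f -> f %| g ^+ k -> f %| g.
Proof.
move=> f_sep f_gk; set h := gcdp f g.
have fE : f = (f %/ h) * h by rewrite divpK ?dvdp_gcdl.
have fh_f : f %/ h %| f by rewrite {2}fE dvdp_mulr.
have fh_g : coprimep (f %/ h) g.
  have : coprimep (f %/ h) h by apply: separable_coprime f_sep _; rewrite -fE.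
  move/coprimepP=> fh_h; apply/coprimepP => d d_fh d_g.
  by apply: fh_h; rewrite // dvdp_gcd d_g (dvdp_trans d_fh).
have fh1 : f %/ h %| 1.
  rewrite -(Gauss_dvdpr _ (coprimep_expr k fh_g)) mulr1.
  exact: dvdp_trans f_gk.
rewrite fE (dvdp_trans (dvdp_mul fh1 (dvdpp h))) //.
by rewrite mul1r dvdp_gcdr.
Qed.

Lemma separable_XnsubC (R : idomainType) n (c : R) :
  n%:R != 0 :> R -> c != 0 -> separable_poly ('X^n - c%:P).
Proof.
case: n => [/eqP// | n nz_n nz_c]; rewrite unlock derivB derivC subr0.
rewrite derivXn -scaler_nat coprimepZr //= exprS coprimep_sym -polyCN.
rewrite coprimep_addl_mul -alg_polyC coprimepZr ?coprimep1 //.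
by rewrite oppr_eq0.
Qed.

Lemma poly_take_coef_drop (R : nzRingType) j (g : {poly R}) :
  take_poly j g + (g`_j *: 'X^j + drop_poly j.+1 g * 'X^(j.+1)) = g.
Proof.
rewrite -[RHS](poly_take_drop j); congr (_ + _).
rewrite -[X in _ = X * _](poly_take_drop 1) mulrDl -mulrA -exprD add1n.
rewrite [take_poly 1 _]size1_polyC ?size_take_poly // coef_take_poly.
rewrite coef_drop_poly add0n mul_polyC; congr (_ + _ * _).
by apply/polyP => i; rewrite !coef_drop_poly -addnA add1n.
Qed.

Section IntegralDivisibility.

Variables (R K : comNzRingType) (RtoK : {rmorphism R -> K}).
Implicit Types (x y z : K) (g : {poly R}).

Definition horner_over x : {poly R} -> K :=
  horner_morph (fun a : R => mulrC x (RtoK a)).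

HB.instance Definition _ x := GRing.RMorphism.on (horner_over x).

Lemma horner_overC x a : horner_over x a%:P = RtoK a.
Proof. exact: horner_morphC. Qed.

Lemma horner_overX x : horner_over x 'X = x.
Proof. exact: horner_morphX. Qed.

Lemma horner_overXn x n : horner_over x 'X^n = x ^+ n.
Proof. by rewrite rmorphXn /= horner_overX. Qed.

Lemma horner_overZ x a g : horner_over x (a *: g) = RtoK a * horner_over x g.
Proof. by rewrite -mul_polyC rmorphM /= horner_overC. Qed.

Lemma horner_over_rmorph a g : horner_over (RtoK a) g = RtoK g.[a].
Proof. exact: horner_map. Qed.

Lemma horner_over_comp x g h :
  horner_over x (h \Po g) = horner_over (horner_over x g) h.
Proof. by rewrite /horner_over /horner_morph map_comp_poly horner_comp. Qed.

Lemma horner_over_wide n x g : (size g <= n)%N ->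
  horner_over x g = \sum_(i < n) RtoK g`_i * x ^+ i.
Proof.
move=> g_n; rewrite /horner_over /horner_morph (@horner_coef_wide _ n).
  by apply: eq_bigr => i _; rewrite coef_map.
exact: leq_trans (size_poly _ _) g_n.
Qed.

Lemma integral_exp x n : integralOver RtoK x -> integralOver RtoK (x ^+ n).
Proof.
move=> x_int; elim: n => [|n IHn]; first exact: integral1.
by rewrite exprS; apply: integral_mul.
Qed.

Lemma integral_horner_over x g :
  integralOver RtoK x -> integralOver RtoK (horner_over x g).
Proof.
apply: integral_horner; apply/integral_poly => i.
by rewrite coef_map; apply: integral_id.
Qed.

Definition integral_dvd x y := exists2 z, integralOver RtoK z & y = x * z.

Lemma integral_dvdB x y z :
  integral_dvd x y -> integral_dvd x z -> integral_dvd x (y - z).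
Proof.
move=> [y' y'_int ->] [z' z'_int ->]; exists (y' - z'); last by rewrite mulrBr.
exact: integral_sub.
Qed.

Lemma integral_dvdMr x y z :
  integralOver RtoK z -> integral_dvd x y -> integral_dvd x (y * z).
Proof.
move=> z_int [y' y'_int ->]; exists (y' * z); last by rewrite mulrA.
exact: integral_mul.
Qed.

(* Clearing denominators in a monic equation of [y / RtoK a]. *)
Lemma integral_dvd_exp_horner a y : integral_dvd (RtoK a) y ->
  exists n h, y ^+ n = RtoK a * horner_over y h.
Proof.
case=> x [f f_mon /rootP fx0] yE.
pose n := (size f).-1; have f_size : size f = n.+1.
  by rewrite /n prednK // size_poly_gt0 monic_neq0.
pose h := \poly_(i < n) (f`_i * a ^+ (n - i).-1).
suff fyE : y ^+ n + RtoK a * horner_over y h = RtoK a ^+ n * horner_over x f.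
  exists n, (- h); apply/eqP; rewrite rmorphN mulrN -addr_eq0 fyE.
  by rewrite [horner_over x f]fx0 mulr0.
rewrite {}yE.
rewrite (@horner_over_wide n.+1 x f) ?f_size // big_ord_recr /=.
rewrite -[f`_n]lead_coefE (monicP f_mon) rmorph1 mul1r mulrDr -exprMn addrC.
congr (_ + _); rewrite (@horner_over_wide n) ?size_poly // !mulr_sumr.
apply: eq_bigr => i _; rewrite coef_poly ltn_ord rmorphM rmorphXn /= exprMn.
have -> : RtoK a ^+ n = RtoK a * RtoK a ^+ (n - i).-1 * RtoK a ^+ i.
  by rewrite -exprS prednK ?subn_gt0 // -exprD subnK // ltnW.
by ring.
Qed.

End IntegralDivisibility.

Lemma irreducible_dvdp_root (R K : idomainType) (RtoK : {rmorphism R -> K})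
    (x : K) (f g : {poly R}) :
  injective RtoK -> irreducible_poly f ->
  horner_over RtoK x f = 0 -> horner_over RtoK x g = 0 -> f %| g.
Proof.
move=> RtoK_inj f_irr fx0 gx0; apply: contraT.
rewrite -irreducible_poly_coprime // => /Bezout_coprimepP[[u v] /=].
rewrite eqp_sym => /eqpP[[c d] /= /andP[c_neq0 _]].
move=> /(congr1 (horner_over RtoK x)).
rewrite !horner_overZ rmorph1 rmorphD !rmorphM /= fx0 gx0.
rewrite !mulr0 addr0 mulr0 mulr1.
by move/eqP; rewrite -(rmorph0 RtoK) (inj_eq RtoK_inj) (negPf c_neq0).
Qed.

Lemma lalg_intr_inj (F : numFieldType) (A : lalgType F) :
  injective (intr : int -> A).
Proof.
move=> a b; rewrite -!(rmorph_int (GRing.in_alg A)).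
by move/fmorph_inj/intr_inj.
Qed.

Lemma lalg_intr_eq0 (F : numFieldType) (A : lalgType F) (a : int) :
  (a%:~R == 0 :> A) = (a == 0).
Proof. by rewrite -(inj_eq (@lalg_intr_inj F A)). Qed.

Section EisensteinPolynomials.

Variable p : nat.
Implicit Types f : {poly int}.

Definition eisenstein_at f :=
  [/\ (1 < size f)%N, f \is monic, ~~ (p%:Z ^+ 2 %| f`_0)%Z
    & forall i, (i < (size f).-1)%N -> (p %| f`_i)%Z].

Lemma eisenstein_irreducible f :
  prime p -> eisenstein_at f -> irreducible_poly f.
Proof.
move=> p_pr [f_size f_mon f0 f_p]; apply: (eisenstein_crit p_pr) => //.
  by rewrite gtn_eqF.
by rewrite (monicP f_mon) dvdzE Euclid_dvd1.
Qed.

Lemma eisenstein_decomposition f : eisenstein_at f ->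
  exists h c, f = 'X^((size f).-1) + p%:Z *: (h * 'X + c%:P) /\ ~~ (p %| c)%Z.
Proof.
move=> [f_size f_mon f0 f_p]; set n := (size f).-1.
have n_gt0 : (0 < n)%N by rewrite -ltnS prednK // ltnW.
have /polyOver_dvdzP[v fv] : f - 'X^n \is a polyOver (dvdz p%:Z).
  apply/polyOverP => i; rewrite coefB coefXn.
  have [i_n | n_i | ->] := ltngtP i n; first by rewrite subr0; apply: f_p.
    by rewrite subr0 nth_default ?rpred0 // -(prednK (ltnW f_size)).
  by rewrite -lead_coefE (monicP f_mon) subrr rpred0.
exists (drop_poly 1 v), v`_0; split.
  apply/eqP; rewrite addrC -subr_eq fv; apply/eqP; congr (_ *: _).
  by rewrite -{1}(poly_take_drop 1 v) addrC [take_poly 1 v]size1_polyC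
             ?size_take_poly // coef_take_poly.
apply: contra f0; have /(congr1 (fun g : {poly int} => g`_0)) := fv.
rewrite coefB coefXn coefZ (ltn_eqF n_gt0) subr0 expr2 => ->.
exact: dvdz_mul.
Qed.

Lemma eisenstein_XnsubC n (m : int) : (0 < n)%N ->
  (p %| m)%Z -> ~~ (p%:Z ^+ 2 %| m)%Z -> eisenstein_at ('X^n - m%:P).
Proof.
move=> n_gt0 p_m p2_m.
have XnsubC_coef i : (i < n)%N -> ('X^n - m%:P)`_i = (- m) *+ (i == 0)%N.
  move=> i_n; rewrite coefB coefXn coefC (ltn_eqF i_n) sub0r mulrb.
  by case: eqP => //; rewrite oppr0.
split; rewrite ?size_XnsubC ?monicXnsubC //.
  by rewrite XnsubC_coef // rpredN.
by move=> i i_n; rewrite XnsubC_coef // rpredMn // rpredN.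
Qed.

End EisensteinPolynomials.

Section PMaximality.

Variables (K : fieldExtType rat) (theta : K) (p : nat).
Hypothesis p_pr : prime p.

Local Notation intrK := (intr : {rmorphism int -> K}).
Local Notation eval := (horner_over intrK).
Local Notation p_dvd := (integral_dvd intrK (intrK p)).

(* If [K] has degree [n] and is generated by [theta], this says that [p] does
   not divide the index of [Z[theta]] in the ring of integers. *)
Definition p_maximal n := forall g : {poly int},
  (size g <= n)%N -> p_dvd (eval theta g) -> g \is a polyOver (dvdz p).

Lemma prime_intr_neq0 : intrK p != 0.
Proof. by rewrite lalg_intr_eq0 eqz_nat -lt0n prime_gt0. Qed.

Lemma integral_dvd_prime_intr a : p_dvd (intrK a) -> (p %| a)%Z.
Proof.
case/integral_dvd_exp_horner => k [h].
rewrite horner_over_rmorph -rmorphXn -rmorphM => /lalg_intr_inj ak.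
have : (p %| a ^+ k)%Z by rewrite ak dvdz_mulr.
by rewrite Euclid_dvdzX // => /andP[].
Qed.

Lemma p_maximal_denominator n (a : 'I_n -> int) (q : int) :
  p_maximal n -> q != 0 -> \big[gcdz/q]_(i < n) a i = 1 ->
  in_ring_of_integers ((\sum_(i < n) (a i)%:~R * theta ^+ i) / q%:~R) ->
  ~~ (p %| q)%Z.
Proof.
set alpha := _ / _ => theta_max q_neq0 gcd_aq alpha_int; apply/negP => p_q.
pose g := rVpoly (\row_i a i).
have g_coef (i : 'I_n) : g`_i = a i by rewrite coef_rVpoly_ord mxE.
have /polyOverP p_g : g \is a polyOver (dvdz p).
  apply: theta_max; first exact: size_poly.
  have [c qE] := dvdzP p_q; rewrite mulrC in qE.
  exists (intrK c * alpha).
    by apply: integral_mul; first exact: integral_id.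
  rewrite mulrA -rmorphM -qE mulrC divfK ?lalg_intr_eq0 //.
  rewrite (@horner_over_wide _ _ _ n) ?size_poly //.
  by apply: eq_bigr => i _; rewrite g_coef.
have : (p %| \big[gcdz/q]_(i < n) a i)%Z.
  by apply: dvdz_biggcd => // i _; rewrite -g_coef.
by rewrite gcd_aq dvdzE Euclid_dvd1.
Qed.

Lemma separable_p_maximal (f : {poly int}) :
  f \is monic -> irreducible_poly f ->
  separable_poly (map_poly (intr : int -> 'F_p) f) ->
  eval theta f = 0 -> p_maximal (size f).-1.
Proof.
move=> f_mon f_irr fp_sep f_theta g g_size /integral_dvd_exp_horner[k [h gk]].
have p0 : p%:Z%:~R = 0 :> 'F_p.
  by apply/eqP; rewrite -(dvdz_pcharf (pchar_Fp p_pr)).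
pose r := g ^+ k - p%:Z *: (h \Po g).
have [s rE] : exists s, r = f * s.
  have f_r : f %| r.
    apply: irreducible_dvdp_root (@lalg_intr_inj _ K) f_irr f_theta _.
    by rewrite rmorphB rmorphXn /= horner_overZ horner_over_comp gk subrr.
  by have [s ->] := dvdpP_int f_r; exists s; rewrite zprimitive_monic.
have fp_gp : map_poly intr f %| map_poly (intr : int -> 'F_p) g.
  apply: (separable_dvdp_exp (k := k)) fp_sep _; rewrite -rmorphXn /=.
  have -> : g ^+ k = f * s + p%:Z *: (h \Po g) by rewrite -rE subrK.
  by rewrite rmorphD rmorphM /= map_polyZ /= p0 scale0r addr0 dvdp_mulr.
have gp0 : map_poly (intr : int -> 'F_p) g = 0.
  apply/eqP; apply: contraLR fp_gp => gp_neq0.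
  rewrite gtNdvdp // [ltnRHS]size_map_poly_id0 ?(monicP f_mon) ?oner_eq0 //.
  apply: leq_ltn_trans (leq_trans (size_poly _ _) g_size) _.
  by rewrite ltn_predL size_poly_gt0 monic_neq0.
apply/polyOverP => i; rewrite (dvdz_pcharf (pchar_Fp p_pr)).
by rewrite -coef_map gp0 coef0.
Qed.

Section EisensteinRoot.

Variable f : {poly int}.
Hypotheses (f_eis : eisenstein_at p f) (f_theta : eval theta f = 0).

Local Notation n := (size f).-1.

Let n_gt0 : (0 < n)%N.
Proof. by case: f_eis => f_size _ _ _; rewrite -ltnS prednK // ltnW. Qed.

Let theta_integral : integralOver intrK theta.
Proof. by exists f; [case: f_eis | apply/rootP]. Qed.

Lemma eisenstein_root_eq : exists (h : {poly int}) (c : int),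
  theta ^+ n = - intrK p * (eval theta h * theta + intrK c) /\ ~~ (p %| c)%Z.
Proof.
have [h [c [fE p_c]]] := eisenstein_decomposition f_eis.
exists h, c; split=> //; apply/eqP; rewrite mulNr -addr_eq0 -[eqbRHS]f_theta.
rewrite [in eqbRHS]fE rmorphD /= horner_overXn horner_overZ rmorphD rmorphM /=.
by rewrite horner_overX horner_overC.
Qed.

Lemma eisenstein_root_exp : p_dvd (theta ^+ n).
Proof.
have [h [c [-> _]]] := eisenstein_root_eq; rewrite mulNr -mulrN.
exists (- (eval theta h * theta + intrK c)) => //; apply: integral_opp.
apply: integral_add; last exact: integral_id.
apply: integral_mul theta_integral.
exact/integral_horner_over/theta_integral.
Qed.

(* Multiplied by [theta / p], the hypothesis says that [theta] divides
   [a * (h(theta) * theta + c)], hence [a * c]; but [p] divides [theta ^+ n]. *)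
Lemma eisenstein_dvd_lead a : p_dvd (intrK a * theta ^+ n.-1) -> (p %| a)%Z.
Proof.
have [h [c [thetaXn p_c]]] := eisenstein_root_eq.
case=> y y_int ay; pose w := - (y + intrK a * eval theta h).
have w_int : integralOver intrK w.
  apply/integral_opp/integral_add => //; apply: integral_mul.
    exact: integral_id.
  exact/integral_horner_over/theta_integral.
have ac : intrK (a * c) = theta * w.
  apply: (mulfI prime_intr_neq0); rewrite rmorphM /=.
  have : intrK p * y * theta =
      - intrK a * (intrK p * (eval theta h * theta + intrK c)).
    by rewrite -ay -mulrA -exprSr prednK // thetaXn; ring.
  by rewrite /w => yE; ring: yE.
have : p_dvd (intrK ((a * c) ^+ n)).
  rewrite rmorphXn /= ac exprMn; apply: integral_dvdMr eisenstein_root_exp.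
  exact: integral_exp.
move/integral_dvd_prime_intr; rewrite Euclid_dvdzX // Euclid_dvdzM //.
by rewrite (negPf p_c) orbF => /andP[].
Qed.

Lemma eisenstein_p_maximal : p_maximal n.
Proof.
move=> g g_size p_g; apply/polyOverP => j; elim/ltn_ind: j => j IHj.
have [n_j | j_n] := leqP n j.
  by rewrite nth_default ?rpred0 // (leq_trans g_size).
apply: eisenstein_dvd_lead.
have /polyOver_dvdzP[g' g'E] : take_poly j g \is a polyOver (dvdz p).
  apply/polyOverP => i; rewrite coef_take_poly.
  by have [/IHj | _] := ltnP i j; rewrite ?rpred0.
have [k nE] : exists k, n = (j + k).+1.
  by exists (n - j.+1)%N; rewrite -addSn subnKC.
have -> : intrK g`_j * theta ^+ n.-1 = eval theta g * theta ^+ k -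
    intrK p * eval theta g' * theta ^+ k -
    theta ^+ n * eval theta (drop_poly j.+1 g).
  rewrite -{2}(poly_take_coef_drop j g) g'E !(rmorphD, rmorphM) /=.
  by rewrite !horner_overZ !horner_overXn nE exprD !exprS exprD; ring.
have theta_k_int := integral_exp k theta_integral.
apply: integral_dvdB; first apply: integral_dvdB.
- exact: integral_dvdMr.
- apply: integral_dvdMr => //; exists (eval theta g') => //.
  exact/integral_horner_over/theta_integral.
- apply: integral_dvdMr eisenstein_root_exp.
  exact/integral_horner_over/theta_integral.
Qed.

End EisensteinRoot.

End PMaximality.

Lemma squarefree_XnsubC_irreducible n (m : int) : (0 < n)%N ->
  squarefree_int m -> (1 < `|m|)%N -> irreducible_poly ('X^n - m%:P).
Proof.
move=> n_gt0 m_sqf m_gt1; have p_pr := pdiv_prime m_gt1.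
apply: (eisenstein_irreducible p_pr); apply: eisenstein_XnsubC => //.
  by rewrite dvdzE absz_nat pdiv_dvd.
exact: squarefree_int_prime.
Qed.

Lemma squarefree_root_p_maximal (K : fieldExtType rat) (theta : K) n (m : int)
    (p : nat) :
  (0 < n)%N -> squarefree_int m -> (1 < `|m|)%N -> theta ^+ n = m%:~R ->
  prime p -> (p %| n)%N ==> (p %| m)%Z -> p_maximal theta p n.
Proof.
move=> n_gt0 m_sqf m_gt1 thetaXn p_pr /implyP pn_imp_pm.
have XnsubC_theta : horner_over intr theta ('X^n - m%:P) = 0.
  by rewrite rmorphB /= horner_overXn horner_overC thetaXn subrr.
have -> : n = (size ('X^n - m%:P : {poly int})).-1 by rewrite size_XnsubC.
have [p_m | p_ndvd_m] := boolP (p %| m)%Z.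
  apply: eisenstein_p_maximal XnsubC_theta => //.
  by apply: eisenstein_XnsubC => //; apply: squarefree_int_prime.
apply: separable_p_maximal XnsubC_theta => //; first exact: monicXnsubC.
  exact: squarefree_XnsubC_irreducible.
rewrite rmorphB /= map_polyXn map_polyC; apply: separable_XnsubC.
  by rewrite -(dvdn_pcharf (pchar_Fp p_pr)); apply: contra p_ndvd_m.
by rewrite -(dvdz_pcharf (pchar_Fp p_pr)).
Qed.

Theorem theorem1 (n : nat) (m : int) (K : fieldExtType rat) (theta : K)
    (n_gt2 : (2 < n)%N)
    (m_neq0 : m <> 0) (m_neq1 : m <> 1) (m_neqN1 : m <> -1)
    (m_sqfree : squarefree_int m)
    (theta_root : theta ^+ n = m%:~R)
    (K_gen : <<1; theta>>%VS = fullv)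
    (not_power_basis : ~ integral_basis [tuple theta ^+ i | i < n])
    (k : nat) (b : k.-tuple K) (b_basis : integral_basis b)
    (alpha : K) (alpha_in_b : alpha \in b)
    (a : 'I_n -> int) (q : int) (q_gt0 : 0 < q)
    (gcd_aq : \big[gcdz/q]_(i < n) a i = 1)
    (alphaE : alpha = (\sum_(i < n) (a i)%:~R * theta ^+ i) / q%:~R) :
  forall p : nat, prime p -> (p%:Z %| q)%Z -> (p %| n)%N /\ ~ (p%:Z %| m)%Z.
Proof.
move=> p p_pr p_q.
have n_gt0 : (0 < n)%N by exact: leq_trans n_gt2.
have m_gt1 : (1 < `|m|)%N.
  by case: (m) m_neq0 m_neq1 m_neqN1 => [[|[|]]|[|]].
have alpha_int : in_ring_of_integers alpha.
  by have [b_int _ _] := b_basis; have /tnthP[i ->] := alpha_in_b.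
have p_not_maximal : ~ p_maximal theta p n.
  move=> theta_max; move: p_q; apply/negP; rewrite alphaE in alpha_int.
  by apply: p_maximal_denominator theta_max _ gcd_aq alpha_int; rewrite ?gt_eqF.
have : ~~ ((p %| n)%N ==> (p %| m)%Z).
  apply/negP => pn_imp_pm; apply: p_not_maximal.
  exact: squarefree_root_p_maximal theta_root p_pr pn_imp_pm.
by rewrite negb_imply => /andP[-> /negP].
Qed.
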